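(* Let $n = p_1^{\alpha_1}\cdots p_r^{\alpha_r}$ be the prime factorisation of a positive integer $n$ (distinct primes, $\alpha_j>0$). Then the set of primes dividing at least one diagonal entry of the diagonal matrix $\bigotimes_{j=1}^r S(A_{p_j^{\alpha_j}})$ (Kronecker product) is $\{p_1,\dots,p_r\}$, and for each $j$ the weakly decreasing rearrangement of the exponents of $p_j$ in the $n$ diagonal entries consists of the value $\alpha_j - i$ repeated $\phi(p_j^i)\, n / p_j^{\alpha_j}$ times, for $0 \le i \le \alpha_j$.
   Context: For a positive integer $k$, let $\Phi_d$ denote the $d$th cyclotomic polynomial and let $\Psi_k : \mathbf{Z}[X]/(X^k-1) \to \bigoplus_{d \mid k} \mathbf{Z}[X]/(\Phi_d(X))$ be the natural map $f \bmod (X^k-1) \mapsto \bigoplus_{d\mid k} f \bmod \Phi_d(X)$, with bases $(1,\overline{X},\dots,\overline{X}^{k-1})$ on the domain, $(1,\overline{X},\dots,\overline{X}^{\phi(d)-1})$ on each summand, summands ordered by increasing $d$; $A_k$ is the matrix of $\Psi_k$ in these bases. $S(A)$ denotes the Smith normal form of an integer matrix $A$ with non-negative diagonal entries. $\phi$ is Euler's totient function. *)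

(* Defs.v *)
From HB Require Import structures.
From mathcomp Require Import all_boot all_order all_algebra.
From mathcomp Require Import cyclotomic mxtens.
From Stdlib Require Import ClassicalEpsilon.

Set Implicit Arguments.
Unset Strict Implicit.
Unset Printing Implicit Defensive.

Import Order.TTheory GRing.Theory Num.Theory.
Local Open Scope ring_scope.

(* Row labels of the codomain basis of Psi_k: pairs (d, i) with d | k taken
   in increasing order and 0 <= i < phi(d); the row of index r is the r-th
   element of this list (which has length \sum_{d|k} phi(d) = k). *)
Definition Psi_rows (k : nat) : seq (nat * nat) :=
  flatten [seq [seq (d, i) | i <- iota 0 (totient d)] | d <- divisors k].

(* A_k : matrix of Psi_k : Z[X]/(X^k-1) -> (+)_{d|k} Z[X]/(Phi_d).
   Column c <-> domain basis vector X^c; row r <-> (d,i), and the entry is the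
   coefficient of X^i in (X^c mod Phi_d). *)
Definition A_mx (k : nat) : 'M[int]_k :=
  \matrix_(r < k, c < k)
    let: (d, i) := nth (0%N, 0%N) (Psi_rows k) r in ('X^c %% 'Phi_d)`_i.

Definition is_SNF (k : nat) (A D : 'M[int]_k) : Prop :=
  [/\ (forall i j : 'I_k, i != j -> D i j = 0),
      (forall i : 'I_k, 0 <= D i i),
      (forall i j : 'I_k, (i <= j)%N -> (D i i %| D j j)%Z) &
      exists L R : 'M[int]_k,
        [/\ L \in unitmx, R \in unitmx & A = L *m D *m R]].

Definition SNF (k : nat) (A : 'M[int]_k) : 'M[int]_k :=
  epsilon (inhabits (0 : 'M[int]_k)) (is_SNF A).

Fixpoint kron_list (l : seq {m : nat & 'M[int]_m}) : {m : nat & 'M[int]_m} :=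
  match l with
  | [::] => existT _ 1%N (1%:M : 'M[int]_1)
  | x :: l' => let y := kron_list l' in
      existT _ (projT1 x * projT1 y)%N (tensmx (projT2 x) (projT2 y))
  end.

Definition kron_SNF (n : nat) : {m : nat & 'M[int]_m} :=
  kron_list [seq existT (fun m => 'M[int]_m) (p ^ logn p n)%N
                        (SNF (A_mx (p ^ logn p n)%N)) | p <- primes n].

Definition diag_entries (M : {m : nat & 'M[int]_m}) : seq int :=
  [seq projT2 M i i | i <- enum 'I_(projT1 M)].

(* Main.v *)
(* For k = p^a, the polynomials X^j (X^k - 1)/(X^(p^e) - 1) with 0 <= e <= a and
   0 <= j < phi(p^e) are monic with degrees 0, ..., k - 1 in some order, hence
   form a basis of Z[X]/(X^k - 1).  The factor (X^k - 1)/(X^(p^e) - 1) vanishes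
   modulo Phi_(p^f) for f > e and is p^(a-e) modulo Phi_(p^f) for f <= e, so in
   this basis A_k becomes L D with L unitriangular and D = diag(p^(a-e)), where
   p^(a-e) is repeated phi(p^e) times.  Reversing D gives the Smith normal form.
   In the Kronecker product, the exponents of p only come from the factor
   attached to p, each being repeated n / p^(logn p n) times. *)

Require Import Defs.
From HB Require Import structures.
From mathcomp Require Import all_boot all_order all_algebra.
From mathcomp Require Import cyclotomic mxtens.
From mathcomp Require Import fingroup perm zify.
From Stdlib Require Import ClassicalEpsilon.

Set Implicit Arguments.
Unset Strict Implicit.
Unset Printing Implicit Defensive.

Import Order.TTheory GRing.Theory Num.Theory.
Local Open Scope ring_scope.

(** * Uniqueness of the Smith normal form *)

(** Rows 0 to k outnumber the columns before k, so every permutation sends one of them to a column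
    at or after k: each term of the Leibniz expansion meets the block. *)
Lemma dvdz_det_block n (U : 'M[int]_n) (q : int) (k : 'I_n) :
  (forall i j : 'I_n, (i <= k)%N -> (k <= j)%N -> (q %| U i j)%Z) ->
  (q %| \det U)%Z.
Proof.
move=> Uq; rewrite /determinant; apply: rpred_sum => s _; apply: dvdz_mull.
suff [i le_ik le_ksi] : exists2 i : 'I_n, (i <= k)%N & (k <= s i)%N.
  by rewrite (bigD1 i) //= dvdz_mulr // Uq.
apply/exists_inP; apply: contraT; rewrite negb_exists_in => /forall_inP no_i.
pose f (x : 'I_k.+1) : nat := s (widen_ord (ltn_ord k) x).
have f_inj : injective f.
  by move=> x y /val_inj/perm_inj/(congr1 val) /= /val_inj.
have : (size [seq f x | x <- enum 'I_k.+1] <= size (iota 0 k))%N.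
  apply: uniq_leq_size; first by rewrite map_inj_uniq ?enum_uniq.
  move=> _ /mapP[x _ ->]; rewrite mem_iota /= add0n ltnNge.
  by apply: no_i => /=; rewrite -ltnS.
by rewrite size_map size_enum_ord size_iota ltnn.
Qed.

Lemma unitmx_dvdz_det n (U : 'M[int]_n) (q : int) :
  U \in unitmx -> (q %| \det U)%Z -> (`|q| = 1)%N.
Proof.
by rewrite unitmxE => /orP[] /eqP ->; rewrite dvdzE ?abszN dvdn1 => /eqP.
Qed.

(* If q^e divided D k k but not D' k k, then D' U = L D would make the block
   of U with rows <= k and columns >= k vanish modulo q, so that q | det U. *)
Lemma SNF_pfactor_dvd n (A D D' : 'M[int]_n) (q e : nat) (k : 'I_n) :
  is_SNF A D -> is_SNF A D' -> prime q ->
  (q ^ e %| `|D k k|)%N -> (q ^ e %| `|D' k k|)%N.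
Proof.
move=> [diagD _ chainD [L1 [R1 [L1u R1u A1]]]].
move=> [diagD' _ chainD' [L2 [R2 [L2u R2u A2]]]] q_pr qDk.
apply: contraT => nqD'k.
pose L := invmx L2 *m L1; pose U := R2 *m invmx R1.
have Uu : U \in unitmx by rewrite unitmx_mul R2u unitmx_inv.
have D'U_LD : D' *m U = L *m D.
  have : L2 *m (D' *m R2) = L1 *m D *m R1 by rewrite mulmxA -A1 -A2.
  move/(congr1 (fun M => invmx L2 *m M *m invmx R1)).
  by rewrite mulKmx // mulmxA mulmxK // !mulmxA.
clearbody L U; have eq_ent i j : D' i i * U i j = L i j * D j j.
  move/matrixP/(_ i j): D'U_LD; rewrite !mxE (bigD1 i) //= big1 => [|x xi].
    rewrite (bigD1 j) //= big1 ?addr0 // => x xj.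
    by rewrite diagD ?mulr0.
  by rewrite diagD' ?mul0r // eq_sym.
suff /(unitmx_dvdz_det Uu)/= q1 : (q%:Z %| \det U)%Z by rewrite q1 in q_pr.
apply: (@dvdz_det_block _ _ _ k) => i j le_ik le_kj.
have nqD'i : ~~ (q ^ e %| `|D' i i|)%N.
  apply: contra nqD'k => /dvdn_trans; apply.
  by have := chainD' _ _ le_ik.
have : (q ^ e %| `|D' i i| * `|U i j|)%N.
  rewrite -abszM eq_ent abszM dvdn_mull // (dvdn_trans qDk) //.
  exact: chainD.
(* If q did not divide [U i j], the Gauss lemma would make q^e divide [D' i i]. *)
rewrite dvdzE /=; apply: contraLR => nqU.
by rewrite mulnC Gauss_dvdr // coprimeXl // prime_coprime.
Qed.

Lemma dvdn_pfactor_all (m n : nat) :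
  (forall q e, prime q -> (q ^ e %| m)%N -> (q ^ e %| n)%N) -> (m %| n)%N.
Proof.
move=> h; case: (posnP m) => [m0 | m_gt0].
  case: (posnP n) => [-> // | n_gt0].
  (* When m = 0 < n, the power 2^n would divide n although n < 2^n. *)
  have := h 2%N n isT; rewrite m0 => /(_ (dvdn0 _)) /(dvdn_leq n_gt0).
  by rewrite leqNgt ltn_expl.
apply/dvdn_partP => // p; rewrite mem_primes => /and3P[p_pr _ _].
by rewrite p_part h // pfactor_dvdnn.
Qed.

Lemma SNF_unique n (A D D' : 'M[int]_n) : is_SNF A D -> is_SNF A D' -> D = D'.
Proof.
move=> sD sD'; apply/matrixP => i j; case: (eqVneq i j) => [<- | nij]; last first.
  by case: sD => -> // _ _ _; case: sD' => ->.
have [[_ D0 _ _] [_ D'0 _ _]] := (sD, sD').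
rewrite -[LHS]gez0_abs // -[RHS]gez0_abs //; congr Posz.
apply/eqP; rewrite eqn_dvd; apply/andP; split; apply: dvdn_pfactor_all => q e q_pr.
  exact: SNF_pfactor_dvd sD sD' q_pr.
exact: SNF_pfactor_dvd sD' sD q_pr.
Qed.

(** [SNF] is picked by [epsilon]; uniqueness is what lets its value be computed. *)
Lemma SNF_eq n (A D : 'M[int]_n) : is_SNF A D -> SNF A = D.
Proof.
move=> sD; apply: (SNF_unique (A := A) _ sD).
by apply: epsilon_spec; exists D.
Qed.

(** * Row labels for a prime power *)

(* Row r of A_(p^a) is labelled (p^e, i) with e = level p r and
   i = r - level_start p e; level e starts at row p^(e-1), or 0 if e = 0. *)
Definition level (p r : nat) : nat := up_log p r.+1.

Definition level_start (p e : nat) : nat := (p ^ e - totient (p ^ e))%N.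

Lemma totient_le m : (totient m <= m)%N.
Proof.
rewrite totient_count_coprime; apply: leq_trans (leq_sum _ (fun _ _ => leq_b1 _)) _.
by rewrite sum_nat_const_nat muln1 subn0.
Qed.

Lemma level_startK p e : (level_start p e + totient (p ^ e) = p ^ e)%N.
Proof. by rewrite subnK // totient_le. Qed.

Lemma level_start0 p : level_start p 0 = 0%N.
Proof. by rewrite /level_start expn0 (_ : totient 1 = 1%N). Qed.

Lemma level_startS p e : prime p -> level_start p e.+1 = (p ^ e)%N.
Proof.
move=> p_pr; rewrite /level_start totient_pfactor //= expnS.
by rewrite -{1}(prednK (prime_gt0 p_pr)) mulSn addnK.
Qed.

Lemma level_bounds p r : prime p ->
  (level_start p (level p r) <= r < p ^ level p r)%N.
Proof.
move=> p_pr; have p1 := prime_gt1 p_pr.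
(* [up_log_gtn] wants an argument above 1, hence the separate case r = 0. *)
rewrite up_logP // andbT; case: r => [|r]; first by rewrite /level up_log1 level_start0.
have := up_log_gtn p1 (isT : (1 < r.+2)%N); rewrite -/(level p r.+1).
case E: (level p r.+1) => [|e]; first by rewrite level_start0.
by rewrite level_startS.
Qed.

Lemma level_le p a r : prime p -> (r < p ^ a)%N -> (level p r <= a)%N.
Proof. by move=> p_pr lt_r; apply: up_log_min => //; apply: prime_gt1. Qed.

Lemma level_eq p e r : prime p -> (level_start p e <= r < p ^ e)%N -> level p r = e.
Proof.
move=> p_pr; have p1 := prime_gt1 p_pr; case: e => [|e].
  by rewrite expn0 ltnS leqn0 => /andP[_ /eqP ->]; rewrite /level up_log1.
by rewrite level_startS // => h; apply: up_log_eq.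
Qed.

Lemma leq_level p : {homo level p : r s / (r <= s)%N}.
Proof. by move=> r s h; apply: leq_up_log. Qed.

Lemma divisors_pfactor p a : prime p ->
  divisors (p ^ a) = [seq (p ^ i)%N | i <- iota 0 a.+1].
Proof.
move=> p_pr; have p1 := prime_gt1 p_pr.
apply: (irr_sorted_eq ltn_trans ltnn).
- exact: sorted_divisors_ltn.
- rewrite sorted_map; apply: sub_sorted (iota_ltn_sorted 0 a.+1) => i j /=.
  by rewrite ltn_exp2l.
move=> d; rewrite -dvdn_divisors ?expn_gt0 ?prime_gt0 //.
apply/(dvdn_pfactor _ _ p_pr)/mapP => [] [i].
  by move=> le_ia ->; exists i; rewrite // mem_iota.
by rewrite mem_iota add0n => /andP[_ le_ia] ->; exists i.
Qed.

(** The intervals [p^(e-1), p^e), with {0} for e = 0, tile the rows. This serves both for the row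
    labels and for the multiplicities of the exponents. *)
Lemma map_iota_levels (T : Type) p a (f : nat -> T) : prime p ->
  [seq f r | r <- iota 0 (p ^ a)] =
  flatten [seq [seq f (level_start p e + i)%N | i <- iota 0 (totient (p ^ e))]
          | e <- iota 0 a.+1].
Proof.
move=> p_pr; elim: a => [|a IHa].
  by rewrite expn0 /= level_start0.
rewrite -[a.+2]addn1 iotaD map_cat flatten_cat -IHa /= add0n cats0.
rewrite -{1}(level_startK p a.+1) iotaD map_cat level_startS //; congr (_ ++ _).
by rewrite add0n -{1}(addn0 (p ^ a)%N) iotaDl -map_comp.
Qed.

Lemma Psi_rows_pfactor p a : prime p ->
  Psi_rows (p ^ a) =
  [seq (p ^ level p r, r - level_start p (level p r))%N | r <- iota 0 (p ^ a)].
Proof.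
move=> p_pr; rewrite map_iota_levels // /Psi_rows divisors_pfactor // -map_comp.
congr flatten; apply: eq_map => e /=; apply/eq_in_map => i.
rewrite mem_iota add0n /= => lt_i.
rewrite (@level_eq _ e) ?addKn // leq_addr /= -[X in (_ < X)%N]level_startK.
by rewrite ltn_add2l.
Qed.

(** * Coefficient matrices and the quotients of X^(p^a) - 1 *)

(** Each x^t - 1 is a multiple of x - 1. With x = X^(p^e), this reduces [geom_poly p a e] to the
    constant p^(a-e) modulo X^(p^e) - 1. *)
Lemma sum_expr_congr (R : comNzRingType) (x : R) m :
  \sum_(t < m) x ^+ t = m%:R + (x - 1) * \sum_(t < m) \sum_(i < t) x ^+ i.
Proof.
rewrite mulr_sumr -[m in m%:R]card_ord -sumr_const -big_split /=.
by apply: eq_bigr => t _; rewrite -subrX1 addrC subrK.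
Qed.

(** Sorted by degree, the polynomials have a unitriangular coefficient matrix; [N] is transposed
    because [is_trig_mx] means lower triangular. *)
Lemma monic_basis_unitmx k (F : 'I_k -> {poly int}) (s : 'I_k -> 'I_k) :
  injective s -> (forall r, F r \is monic) -> (forall r, size (F r) = (s r).+1) ->
  \matrix_(c, r) (F r)`_c \in unitmx.
Proof.
move=> s_inj F_monic F_size; set M := \matrix_(c, r) _.
pose N := (col_perm (perm s_inj)^-1 M)^T.
suff: N \in unitmx.
  by rewrite unitmx_tr col_permE unitmx_mul unitmx_perm andbT.
have sN (i : 'I_k) : s ((perm s_inj)^-1%g i) = i.
  by rewrite -[s _](permE s_inj) permKV.
have N_trig : is_trig_mx N.
  apply/is_trig_mxP => i j lt_ij; rewrite !mxE nth_default // F_size.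
  by rewrite sN.
rewrite unitmxE det_trig // big1 ?unitr1 // => i _; rewrite !mxE.
have := F_monic ((perm s_inj)^-1%g i); rewrite monicE lead_coefE F_size /= => /eqP.
by rewrite sN.
Qed.

Lemma Cyclotomic_unit d : lead_coef 'Phi_d \is a GRing.unit.
Proof. by rewrite (monicP (Cyclotomic_monic d)) unitr1. Qed.

(** Taking remainders modulo a monic polynomial is linear. The sum is a row of [A_mx] applied to the
    coefficients of F. *)
Lemma modp_Cyclotomic_coef k d i (F : {poly int}) : (size F <= k)%N ->
  \sum_(c < k) ('X^c %% 'Phi_d)`_i * F`_c = (F %% 'Phi_d)`_i.
Proof.
move=> sF; have ud := Cyclotomic_unit d.
have {2}-> : F = \sum_(c < k) F`_c *: 'X^c.
  rewrite -poly_def; apply/polyP => j; rewrite coef_poly.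
  by case: ltnP => // le_kj; rewrite nth_default // (leq_trans sF).
rewrite (big_morph _ (Pdiv.IdomainUnit.modpD ud) (mod0p _)) coef_sum.
by apply: eq_bigr => c _; rewrite Pdiv.IdomainUnit.modpZl // coefZ mulrC.
Qed.

(* This is (X^(p^a) - 1)/(X^(p^e) - 1) when e <= a. *)
Definition geom_poly (p a e : nat) : {poly int} :=
  \sum_(t < p ^ (a - e)) ('X^(p ^ e)) ^+ t.

Lemma geom_polyP p a e : (e <= a)%N ->
  'X^(p ^ a) - 1 = ('X^(p ^ e) - 1) * geom_poly p a e.
Proof. by move=> le_ea; rewrite -subrX1 -exprM -expnD subnKC. Qed.

Lemma Xn_sub_1_monic n : (0 < n)%N -> 'X^n - 1 \is @monic int.
Proof. by move=> n_gt0; rewrite -polyC1 monicXnsubC. Qed.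

Lemma geom_poly_monic p a e : prime p -> (e <= a)%N -> geom_poly p a e \is monic.
Proof.
move=> p_pr le_ea; have p_gt0 := prime_gt0 p_pr.
have Xe := @Xn_sub_1_monic (p ^ e); have := @Xn_sub_1_monic (p ^ a).
rewrite !expn_gt0 p_gt0 /= in Xe *.
by rewrite (geom_polyP _ le_ea) monicMl ?Xe //; apply.
Qed.

Lemma size_geom_poly p a e : prime p -> (e <= a)%N ->
  size (geom_poly p a e) = (p ^ a - p ^ e).+1.
Proof.
move=> p_pr le_ea; have p_gt0 := prime_gt0 p_pr.
have pe_gt0 : (0 < p ^ e)%N by rewrite expn_gt0 p_gt0.
have pa_gt0 : (0 < p ^ a)%N by rewrite expn_gt0 p_gt0.
have := geom_polyP p le_ea; move/(congr1 (size : {poly int} -> nat)).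
rewrite size_monicM ?Xn_sub_1_monic ?monic_neq0 ?geom_poly_monic //.
have : (p ^ e <= p ^ a)%N by rewrite leq_exp2l ?prime_gt1.
by rewrite -polyC1 !size_XnsubC //=; lia.
Qed.

Lemma prod_Cyclotomic_pfactor p a : prime p ->
  \prod_(i <- iota 0 a.+1) 'Phi_(p ^ i) = 'X^(p ^ a) - 1.
Proof.
move=> p_pr; rewrite -prod_Cyclotomic ?expn_gt0 ?prime_gt0 //.
by rewrite divisors_pfactor // big_map.
Qed.

(** ['Phi_(p ^ f)] divides X^(p^e) - 1 as f <= e, so each of the p^(a-e) powers of X^(p^e) is 1
    modulo it. *)
Lemma geom_poly_mod_low p a e f : prime p -> (f <= e)%N -> exists H,
  geom_poly p a e = (p ^ (a - e))%:R + H * 'Phi_(p ^ f).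
Proof.
move=> p_pr le_fe; rewrite /geom_poly sum_expr_congr.
rewrite -prod_Cyclotomic_pfactor // (bigD1_seq f) ?iota_uniq ?mem_iota //=.
by eexists; rewrite -mulrA mulrC; congr (_ + _ * _).
Qed.

(** Cancelling X^(p^e) - 1, the product of the ['Phi_(p ^ i)] for i <= e, from X^(p^a) - 1 leaves
    the product over e < i <= a. *)
Lemma geom_poly_mod_high p a e f : prime p -> (e < f <= a)%N -> exists H,
  geom_poly p a e = H * 'Phi_(p ^ f).
Proof.
move=> p_pr /andP[lt_ef le_fa]; have le_ea : (e <= a)%N by lia.
have pe_gt0 : (0 < p ^ e)%N by rewrite expn_gt0 prime_gt0.
have nz : 'X^(p ^ e) - 1 != 0 :> {poly int} by rewrite monic_neq0 ?Xn_sub_1_monic.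
have := geom_polyP p le_ea; rewrite -prod_Cyclotomic_pfactor //.
rewrite -(@subnKC e.+1 a.+1) // iotaD big_cat prod_Cyclotomic_pfactor //=.
have f_in : f \in iota e.+1 (a.+1 - e.+1) by rewrite mem_iota; lia.
move/(mulfI nz) <-; rewrite (bigD1_seq f) ?iota_uniq //=.
by eexists; rewrite mulrC.
Qed.

(** * The adapted basis and the Smith form for a prime power *)

(** Indexing by row label, not by degree, makes [A_mx] block triangular by levels in this basis. *)
Definition basis_poly (p a r : nat) : {poly int} :=
  'X^(r - level_start p (level p r)) * geom_poly p a (level p r).

Definition basis_deg (p a r : nat) : nat :=
  (r - level_start p (level p r) + (p ^ a - p ^ level p r))%N.

Lemma basis_poly_monic p a r : prime p -> (r < p ^ a)%N -> basis_poly p a r \is monic.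
Proof.
by move=> p_pr lt_r; rewrite monicMl ?monicXn // geom_poly_monic ?level_le.
Qed.

Lemma size_basis_poly p a r : prime p -> (r < p ^ a)%N ->
  size (basis_poly p a r) = (basis_deg p a r).+1.
Proof.
move=> p_pr lt_r; have le_ra := level_le p_pr lt_r.
rewrite size_monicM ?monicXn ?monic_neq0 ?geom_poly_monic //.
by rewrite size_polyXn size_geom_poly // addnS.
Qed.

Lemma basis_deg_lt p a r : prime p -> (r < p ^ a)%N -> (basis_deg p a r < p ^ a)%N.
Proof.
move=> p_pr lt_r; have le_ra := level_le p_pr lt_r.
have : (p ^ level p r <= p ^ a)%N by rewrite leq_exp2l ?prime_gt1.
by have := level_bounds r p_pr; rewrite /basis_deg; lia.
Qed.

(** Level e > 0 fills the degrees from p^a - p^e up to p^a - p^(e-1), excluded, and level 0 only p^a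
    - 1. Thus distinct levels occupy disjoint intervals, in decreasing order. *)
Lemma basis_deg_inj p a : prime p ->
  {in [pred r | (r < p ^ a)%N] &, injective (basis_deg p a)}.
Proof.
move=> p_pr r s; rewrite !inE.
wlog le_rs : r s / (r <= s)%N => [hw|] lt_r lt_s.
  by case/orP: (leq_total r s) => h; [|move/esym] => e; [|apply/esym]; apply: hw e.
have := level_bounds r p_pr; have := level_bounds s p_pr.
have : (p ^ level p s <= p ^ a)%N by rewrite leq_exp2l ?prime_gt1 // level_le.
have := leq_level p le_rs; rewrite /basis_deg leq_eqVlt => /predU1P[-> |]; first by lia.
case: (level p s) => // e lt_re.
have : (p ^ level p r <= p ^ e)%N by rewrite leq_exp2l ?prime_gt1.
by rewrite level_startS //; lia.
Qed.

(** Column s of [A_mx] in the new basis, divided by p^(a-e) for e the level of s; rows of higher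
    level vanish with the geometric factor. *)
Definition left_mx (p a : nat) : 'M[int]_(p ^ a) :=
  \matrix_(r, s) if (level p r <= level p s)%N then
     ('X^(s - level_start p (level p s)) %% 'Phi_(p ^ level p r))
       `_(r - level_start p (level p r)) else 0.

(** Within level e, X^j with j < phi(p^e) is its own remainder, so the diagonal blocks are
    identities and the matrix is upper unitriangular. *)
Lemma left_mx_unit p a : prime p -> left_mx p a \in unitmx.
Proof.
move=> p_pr.
have small (r s : 'I_(p ^ a)) : level p r = level p s -> left_mx p a r s = (r == s)%:R.
  move=> e_rs; have := level_bounds r p_pr; have := level_bounds s p_pr.
  rewrite mxE e_rs leqnn; have := level_startK p (level p s).
  set e := level p s; set b := level_start p e => def_b bs br.
  rewrite modp_small ?coefXn; last by rewrite size_polyXn size_Cyclotomic; lia.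
  by congr (nat_of_bool _)%:R; rewrite -val_eqE /=; lia.
have T_trig : is_trig_mx (left_mx p a)^T.
  apply/is_trig_mxP => i j lt_ij; rewrite mxE.
  have := leq_level p (ltnW lt_ij); rewrite leq_eqVlt => /predU1P[e_ij | lt_e].
    by rewrite small // -val_eqE /= gtn_eqF.
  by rewrite mxE leqNgt lt_e.
rewrite unitmxE -det_tr det_trig // big1 ?unitr1 // => i _.
by rewrite mxE small // eqxx.
Qed.

Lemma A_mx_factor p a : prime p ->
  A_mx (p ^ a) *m (\matrix_(c, r < p ^ a) (basis_poly p a r)`_c) =
  left_mx p a *m diag_mx (\row_r (p ^ (a - level p r))%:R).
Proof.
move=> p_pr; apply/matrixP => r s; rewrite mul_mx_diag !mxE.
under eq_bigr => c _.
  rewrite !mxE Psi_rows_pfactor // (nth_map 0%N) ?size_iota // nth_iota // add0n; over.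
have ud := Cyclotomic_unit (p ^ level p r).
rewrite modp_Cyclotomic_coef; last by rewrite size_basis_poly ?basis_deg_lt.
rewrite /basis_poly; case: leqP => [le_e | lt_e].
  have [H ->] := geom_poly_mod_low a p_pr le_e.
  rewrite mulrDr mulrA Pdiv.IdomainUnit.modpD // modp_mull addr0.
  by rewrite -polyC_natr mulrC mul_polyC Pdiv.IdomainUnit.modpZl // coefZ mulrC.
have [|H ->] := @geom_poly_mod_high p a _ _ p_pr (_ : level p s < level p r <= a)%N.
  by rewrite lt_e level_le.
by rewrite mulrA modp_mull coef0 mul0r.
Qed.

Definition SNF_A (p a : nat) : 'M[int]_(p ^ a) :=
  diag_mx (\row_r (p ^ (a - level p (rev_ord r)))%:R).

Lemma A_mx_SNF p a : prime p -> is_SNF (A_mx (p ^ a)) (SNF_A p a).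
Proof.
move=> p_pr; split.
- by move=> i j nij; rewrite !mxE (negPf nij).
- by move=> i; rewrite !mxE eqxx mulr1n.
- move=> i j le_ij; rewrite !mxE !eqxx !mulr1n !natz dvdzE /= dvdn_exp2l //.
  by rewrite leq_sub2l // leq_level //=; lia.
set M := \matrix_(c, r < p ^ a) (basis_poly p a r)`_c.
have Mu : M \in unitmx.
  pose s (r : 'I_(p ^ a)) := Ordinal (basis_deg_lt p_pr (ltn_ord r)).
  apply: (@monic_basis_unitmx _ (fun r => basis_poly p a r) s).
  - by move=> i j /(congr1 val) /= /(basis_deg_inj p_pr) h; apply/val_inj/h; rewrite inE.
  - by move=> r; apply: basis_poly_monic.
  - by move=> r; apply: size_basis_poly.
(* [W] reverses the order: W^T [SNF_A] W is the diagonal matrix of [A_mx_factor]. *)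
pose W : 'M[int]_(p ^ a) := perm_mx (perm (@rev_ord_inj (p ^ a))).
exists (left_mx p a *m W^T), (W *m invmx M); split.
- by rewrite unitmx_mul left_mx_unit // unitmx_tr unitmx_perm.
- by rewrite unitmx_mul unitmx_perm unitmx_inv.
rewrite mulmxA; apply: (canRL (mulmxK Mu)).
rewrite A_mx_factor // -!mulmxA; congr (_ *m _).
have revV (i : 'I_(p ^ a)) : rev_ord ((perm (@rev_ord_inj (p ^ a)))^-1%g i) = i.
  by rewrite -[rev_ord _](permE (@rev_ord_inj _)) permKV.
rewrite tr_perm_mx -[X in _ *m (_ *m perm_mx X)]invgK -col_permE -row_permE.
apply/matrixP => i j; rewrite !mxE revV.
by rewrite (inj_eq perm_inj).
Qed.

(** * Diagonals of Kronecker products *)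

(** [mxtens_index] is a bijection from pairs of indices. Equality up to order suffices, as the
    exponents get sorted in the end. *)
Lemma perm_diag_tensmx m n (A : 'M[int]_m) (B : 'M[int]_n) :
  perm_eq (diag_entries (existT _ (m * n)%N (tensmx A B)))
    [seq x * y | x <- diag_entries (existT _ m A), y <- diag_entries (existT _ n B)].
Proof.
have pI : perm_eq (enum 'I_(m * n))
    [seq mxtens_index (i, j) | i <- enum 'I_m, j <- enum 'I_n].
  apply: uniq_perm; rewrite ?enum_uniq //.
    apply: allpairs_uniq; rewrite ?enum_uniq // => -[i j] [i' j'] _ _ /=.
    by move/(can_inj (@mxtens_indexK m n)).
  move=> k; rewrite mem_enum inE; symmetry; apply/allpairsP.
  exists (mxtens_unindex k); split; rewrite ?mem_enum //.
  by rewrite -surjective_pairing mxtens_unindexK.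
apply: perm_trans (perm_map _ pI) _.
rewrite /diag_entries /= map_allpairs allpairs_mapl allpairs_mapr.
by rewrite (eq_allpairs _ _ (fun i j => tensmxE A B i j i j)).
Qed.

(** Meant for predicates on the exponent of a prime, which only one factor of x * y affects: this
    form serves when the block of that prime is the head, [count_allpairs_r] when it lies in the
    tail. *)
Lemma count_allpairs_l (S T U : eqType) (f : S -> T -> U) (P : pred U) (Q : pred S) s t :
  {in s & t, forall x y, P (f x y) = Q x} ->
  count P [seq f x y | x <- s, y <- t] = (count Q s * size t)%N.
Proof.
elim: s => [//|x s IHs] PQ; rewrite /= count_cat mulnDl; congr (_ + _)%N.
  rewrite count_map -(count_predT t); case: (boolP (Q x)) => Qx.
    rewrite mul1n; apply: eq_in_count => y yt /=.
    by rewrite PQ ?mem_head.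
  rewrite mul0n; apply/eqP; rewrite -leqn0 leqNgt -has_count; apply/hasPn => y yt /=.
  by rewrite PQ ?mem_head.
by apply: IHs => z y zs yt; apply: PQ; rewrite // inE zs orbT.
Qed.

Lemma count_allpairs_r (S T U : eqType) (f : S -> T -> U) (P : pred U) (Q : pred T) s t :
  {in s & t, forall x y, P (f x y) = Q y} ->
  count P [seq f x y | x <- s, y <- t] = (size s * count Q t)%N.
Proof.
elim: s => [//|x s IHs] PQ; rewrite /= count_cat mulSn; congr (_ + _)%N.
  by rewrite count_map; apply: eq_in_count => y yt; rewrite /= PQ ?mem_head.
by apply: IHs => z y zs yt; apply: PQ; rewrite // inE zs orbT.
Qed.

(** * Exponents of a prime in the Kronecker product *)

Definition expo (q : nat) (e : int) : nat := logn q `|e|.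

(** [logn q 0] is 0, so additivity fails at zero; hence the nonvanishing lemmas below. *)
Lemma expoM q x y : x != 0 -> y != 0 -> expo q (x * y) = (expo q x + expo q y)%N.
Proof. by move=> x0 y0; rewrite /expo abszM lognM ?absz_gt0. Qed.

Definition SNF_block (n p : nat) : {m : nat & 'M[int]_m} :=
  existT (fun m => 'M[int]_m) (p ^ logn p n)%N (SNF (A_mx (p ^ logn p n)%N)).

Lemma size_diag_entries M : size (diag_entries M) = projT1 M.
Proof. by rewrite size_map size_enum_ord. Qed.

Lemma diag_SNF_block n p : prime p ->
  diag_entries (SNF_block n p) =
  [seq (p ^ (logn p n - level p (rev_ord r)))%:Z | r <- enum 'I_(p ^ logn p n)].
Proof.
move=> p_pr; rewrite /diag_entries /= (SNF_eq (A_mx_SNF _ p_pr)).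
by apply: eq_map => r; rewrite !mxE eqxx mulr1n natz.
Qed.

Lemma diag_SNF_block_neq0 n p e : prime p -> e \in diag_entries (SNF_block n p) -> e != 0.
Proof.
move=> p_pr; rewrite diag_SNF_block // => /mapP[r _ ->].
by rewrite -absz_gt0 /= expn_gt0 prime_gt0.
Qed.

Lemma expo_SNF_block_neq n p q e : prime p -> prime q -> q != p ->
  e \in diag_entries (SNF_block n p) -> expo q e = 0%N.
Proof.
move=> p_pr q_pr nqp; rewrite diag_SNF_block // => /mapP[r _ ->].
by rewrite /expo /= lognX (logn_prime q p_pr) (negPf nqp) muln0.
Qed.

(** Up to order the reversal disappears, and the exponent is constant on each level. *)
Lemma perm_expo_SNF_block n p : prime p ->
  perm_eq [seq expo p e | e <- diag_entries (SNF_block n p)]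
    (flatten [seq nseq (totient (p ^ i)) (logn p n - i)%N | i <- iota 0 (logn p n).+1]).
Proof.
move=> p_pr; rewrite diag_SNF_block // -map_comp; set a := logn p n.
have pR : perm_eq [seq rev_ord r | r <- enum 'I_(p ^ a)] (enum 'I_(p ^ a)).
  apply: uniq_perm; rewrite ?enum_uniq ?(map_inj_uniq rev_ord_inj) ?enum_uniq //.
  move=> r; rewrite mem_enum -[r]rev_ordK mem_map ?mem_enum //; exact: rev_ord_inj.
have -> : [seq (expo p \o (fun r : 'I_(p ^ a) => (p ^ (a - level p (rev_ord r)))%:Z)) i
          | i <- enum 'I_(p ^ a)] =
    [seq (a - level p (val r))%N | r <- [seq rev_ord r | r <- enum 'I_(p ^ a)]].
  by rewrite -[RHS]map_comp; apply: eq_map => r; rewrite /expo /= pfactorK.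
apply: perm_trans (perm_map _ pR) _.
rewrite (map_comp (fun r => a - level p r)%N val) val_enum_ord map_iota_levels //.
rewrite (_ : [seq _ | e <- _] = [seq nseq (totient (p ^ i)) (a - i)%N | i <- iota 0 a.+1]) //.
apply: eq_map => e.
(* Writing the length as the size of the left-hand list gives the form of [all_pred1P]: it remains
   to see that the list is constant. *)
rewrite -[totient (p ^ e) in RHS](size_iota 0).
rewrite -(size_map (fun i => a - level p (level_start p e + i))%N).
apply/all_pred1P/allP => x /mapP[i]; rewrite mem_iota add0n /= => lt_i -> {x}.
rewrite (@level_eq _ e) // leq_addr -[X in (_ < X)%N]level_startK.
by rewrite ltn_add2l.
Qed.

(** [kron_SNF n] is the case s = [primes n]; inductions vary s while n, hence each exponent, stays
    fixed. *)
Definition kron_blocks (n : nat) (s : seq nat) : {m : nat & 'M[int]_m} :=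
  kron_list [seq SNF_block n p | p <- s].

Lemma size_diag_kron n s : size (diag_entries (kron_blocks n s)) = (\prod_(p <- s) p ^ logn p n)%N.
Proof.
rewrite size_diag_entries; elim: s => [|p s IHs]; first by rewrite big_nil.
by rewrite big_cons -IHs.
Qed.

Lemma perm_diag_kron_cons n p s :
  perm_eq (diag_entries (kron_blocks n (p :: s)))
    [seq x * y | x <- diag_entries (SNF_block n p), y <- diag_entries (kron_blocks n s)].
Proof.
rewrite /kron_blocks /=; case: (kron_list _) => m B; exact: perm_diag_tensmx.
Qed.

Lemma diag_kron_neq0 n s e : all prime s -> e \in diag_entries (kron_blocks n s) -> e != 0.
Proof.
elim: s e => [|p s IHs] e.
  by move=> _ /mapP[i _ ->]; rewrite /= mxE eqxx.
case/andP=> p_pr s_pr; rewrite (perm_mem (perm_diag_kron_cons n p s)).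
case/allpairsP=> -[x y] [/= xp ys ->].
by rewrite mulf_neq0 ?(diag_SNF_block_neq0 p_pr xp) ?IHs.
Qed.

Lemma expo_kron_notin n s q e : all prime s -> prime q -> q \notin s ->
  e \in diag_entries (kron_blocks n s) -> expo q e = 0%N.
Proof.
elim: s e => [|p s IHs] e.
  by move=> _ _ _ /mapP[i _ ->]; rewrite /= mxE eqxx /expo /= logn1.
case/andP=> p_pr s_pr q_pr; rewrite inE negb_or => /andP[nqp nqs].
rewrite (perm_mem (perm_diag_kron_cons n p s)).
case/allpairsP=> -[x y] [/= xp ys ->].
rewrite expoM ?(diag_SNF_block_neq0 p_pr xp) ?(diag_kron_neq0 s_pr ys) //.
by rewrite (expo_SNF_block_neq p_pr q_pr nqp xp) IHs.
Qed.

(** Only the block of q contributes, each of its entries being repeated as often as the product of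
    the other block sizes; the factor [q ^ logn q n] avoids a division. P is arbitrary because
    [perm_eq] amounts to equality of all counts. *)
Lemma count_expo_kron n s q (P : pred nat) : all prime s -> uniq s -> q \in s ->
  (count P [seq expo q e | e <- diag_entries (kron_blocks n s)] * q ^ logn q n =
   count P [seq expo q e | e <- diag_entries (SNF_block n q)] *
     \prod_(p <- s) p ^ logn p n)%N.
Proof.
move=> s_pr s_uniq qs; have q_pr := allP s_pr q qs.
elim: s s_pr s_uniq qs => [//|p s IHs] /= /andP[p_pr s_pr] /andP[nps s_uniq].
rewrite count_map big_cons (seq.permP (perm_diag_kron_cons n p s)) inE.
case: (eqVneq q p) => [-> _ | nqp /= qs].
  rewrite (@count_allpairs_l _ _ _ _ _ (preim (expo p) P)).
    by rewrite count_map size_diag_kron mulnAC mulnA.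
  move=> x y xp ys /=.
  rewrite expoM ?(diag_SNF_block_neq0 p_pr xp) ?(diag_kron_neq0 s_pr ys) //.
  by rewrite (expo_kron_notin s_pr p_pr nps ys) addn0.
(* The head belongs to another prime and only multiplies the counts by its size. *)
rewrite (@count_allpairs_r _ _ _ _ _ (preim (expo q) P)).
  by rewrite -count_map -mulnA IHs // size_diag_entries mulnCA.
move=> x y xp ys /=.
rewrite expoM ?(diag_SNF_block_neq0 p_pr xp) ?(diag_kron_neq0 s_pr ys) //.
by rewrite (expo_SNF_block_neq p_pr q_pr nqp xp).
Qed.

(** * Assembly over the primes dividing n *)

Lemma prod_primes_logn n : (0 < n)%N -> (\prod_(p <- primes n) p ^ logn p n)%N = n.
Proof. by move=> n_gt0; rewrite [RHS]prod_prime_decomp // prime_decompE big_map. Qed.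

Lemma primes_all_prime n : all prime (primes n).
Proof. by apply/allP => p; rewrite mem_primes => /andP[]. Qed.

Lemma count_flatten_nseq (P : pred nat) (c v : nat -> nat) s N :
  count P (flatten [seq nseq (c i * N)%N (v i) | i <- s]) =
  (count P (flatten [seq nseq (c i) (v i) | i <- s]) * N)%N.
Proof.
elim: s => [//|i s IHs] /=; rewrite !count_cat IHs !count_nseq mulnDl.
by rewrite mulnA.
Qed.

Lemma sorted_flatten_nseq (c : nat -> nat) a s : sorted leq s ->
  sorted geq (flatten [seq nseq (c i) (a - i)%N | i <- s]).
Proof.
have geq_trans : transitive geq by move=> y x z /= yx zy; apply: leq_trans yx.
(* Unlike [sorted], [pairwise] splits directly over the concatenation of the constant runs. *)
rewrite !sorted_pairwise //; last exact: leq_trans.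
elim: s => [//|i s IHs] /= /andP[/allP le_is /IHs ss]; rewrite pairwise_cat ss andbT.
apply/andP; split.
  apply/allrelP => x y /nseqP[-> _] /flatten_mapP[j js /nseqP[-> _]] /=.
  by rewrite leq_sub2l ?le_is.
by elim: (c i) => //= m ->; rewrite all_nseq /= leqnn orbT.
Qed.

Lemma perm_expo_kron n p : (0 < n)%N -> p \in primes n ->
  perm_eq [seq expo p e | e <- diag_entries (kron_SNF n)]
    (flatten [seq nseq (totient (p ^ i) * (n %/ p ^ logn p n))%N (logn p n - i)%N
             | i <- iota 0 (logn p n).+1]).
Proof.
move=> n_gt0 pn; have p_pr := allP (primes_all_prime n) p pn.
apply/seq.permP => P; rewrite count_flatten_nseq -(seq.permP (perm_expo_SNF_block n p_pr)).
have pa_gt0 : (0 < p ^ logn p n)%N by rewrite expn_gt0 prime_gt0.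
(* Multiplying by p^(logn p n) restores the factor in [count_expo_kron] and clears the exact
   quotient. *)
apply/eqP; rewrite -(eqn_pmul2r pa_gt0) -mulnA divnK ?pfactor_dvdnn //.
by rewrite (count_expo_kron _ _ (primes_all_prime n)) ?primes_uniq ?prod_primes_logn.
Qed.

Unset Implicit Arguments.

Theorem theorem2p16 (n : nat) : (0 < n)%N ->
  let diag := diag_entries (kron_SNF n) in
  [/\ size diag = n,
      (forall p : nat, prime p ->
         has (fun e : int => (p%:Z %| e)%Z) diag = (p \in primes n)) &
      (forall p : nat, p \in primes n ->
         sort geq [seq logn p `|e|%N | e <- diag] =
         flatten [seq nseq (totient (p ^ i) * (n %/ p ^ logn p n))%N
                           (logn p n - i)%N
                 | i <- iota 0 (logn p n).+1])].
Proof.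
move=> n_gt0 diag; have s_pr := primes_all_prime n.
have dvd_expo p e : prime p -> e \in diag -> (p%:Z %| e)%Z = (0 < expo p e)%N.
  move=> p_pr /(diag_kron_neq0 s_pr) e0; rewrite dvdzE /= /expo.
  by rewrite -pfactor_dvdn // absz_gt0.
split; first by rewrite size_diag_kron prod_primes_logn.
  move=> p p_pr; case: (boolP (p \in primes n)) => pn; last first.
    apply/hasPn => e ed; rewrite dvd_expo //.
    by rewrite (expo_kron_notin s_pr p_pr pn ed).
  have [a_gt0 pa_n] : (0 < logn p n)%N /\ (p ^ logn p n <= n)%N.
    by rewrite logn_gt0 pn dvdn_leq ?pfactor_dvdnn.
  (* The full exponent is the value for i = 0, of multiplicity n / p^(logn p n) > 0. *)
  have : logn p n \in [seq expo p e | e <- diag].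
    rewrite (perm_mem (perm_expo_kron n_gt0 pn)); apply/flatten_mapP.
    exists 0%N; rewrite ?mem_iota // subn0 mem_nseq eqxx andbT mul1n.
    by rewrite divn_gt0 ?expn_gt0 ?prime_gt0.
  case/mapP=> e ed def_a; apply/hasP; exists e => //.
  by rewrite dvd_expo // -def_a.
move=> p pn; apply: (@sorted_eq _ geq).
- by move=> y x z /= yx zy; apply: leq_trans yx.
- by move=> x y; rewrite /= andbC -eqn_leq => /eqP.
- by apply: sort_sorted => x y; apply: leq_total.
- exact: sorted_flatten_nseq (iota_sorted 0 _).
- by rewrite perm_sort perm_expo_kron.
Qed.
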